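(* Let $l\ge2$ be an integer and $\lambda>\lambda_{l+1}$. There is a constant $\alpha(l,\lambda)\in(0,1)$, depending only on $l$ and $\lambda$, with the following property. Let $\mathfrak N$ be a $\lambda$-lacunary sequence of positive integers, let $T=\{t_{n,m}\}$ be a summation matrix satisfying conditions 1)–3) of the context, and let $c_m$, $m\in\mathfrak N_+^*(l)$, be complex numbers. If the sums $$\sum_{m\in\mathfrak N_+^*(l)}t_{n,m}c_me^{2\pi imx}$$ converge to zero as $n\to\infty$ for every $x$ in a measurable set $E\subset(0,1)$ of Lebesgue measure $|E|>\alpha(l,\lambda)$, then $c_m=0$ for all $m\in\mathfrak N_+^*(l)$.
   Context: For an integer $l\ge2$, $\lambda_{l+1}$ is the unique solution $x>1$ of $x^{l}=x^{l-1}+x^{l-2}+\dots+1$. A sequence of positive integers $\{n_k\}_{k\ge1}$ is $\lambda$-lacunary ($\lambda>1$) if $n_{k+1}/n_k>\lambda$ for all $k$. For $\mathfrak N=\{n_k\}_{k\ge1}$ and $s\ge1$, $\mathfrak N_+(s)$ is the set of integers of the form $n_{k_1}+n_{k_2}+\dots+n_{k_s}$ with $k_1>k_2>\dots>k_s\ge1$, and $\mathfrak N_+^*(l)=\bigcup_{1\le s\le l}\mathfrak N_+(s)$. Conditions on a matrix $T=\{t_{n,m}:\ m\in\mathbb Z,\ n=1,2,\ldots\}$ of numbers: 1) for each $n$ only finitely many of the $t_{n,m}$, $m\in\mathbb Z$, are nonzero; 2) there is a constant $M$ with $|t_{n,m}|\le M$ for all $n,m$; 3) $\lim_{n\to\infty}t_{n,m}=1$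 for every $m=1,2,\ldots$. *)

(* Defs.v *)
From HB Require Import structures.
From mathcomp Require Import all_boot all_order all_algebra.
From mathcomp Require Import all_classical all_reals all_analysis.
From mathcomp Require Import complex.

Set Implicit Arguments.
Unset Strict Implicit.
Unset Printing Implicit Defensive.

Import Order.TTheory GRing.Theory Num.Theory numFieldNormedType.Exports.
Local Open Scope classical_set_scope.
Local Open Scope ring_scope.
Local Open Scope complex_scope.

(* [R[i]] gets the topology of its norm, as every [numFieldType] does. *)
HB.instance Definition _ (R : realType) := NormedModule.copy R[i] R[i]^o.

Section CriticalRatio.
Variable R : realType.

Definition critical_ratio_spec (k : nat) (x : R) : Prop :=
  1 < x /\ x ^+ k.-1 = \sum_(i < k.-1) x ^+ i.

Definition critical_ratio (k : nat) : R := xget 0 (critical_ratio_spec k).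

Lemma critical_ratio_exists (l : nat) : (2 <= l)%N ->
  exists x, critical_ratio_spec l.+1 x.
Proof.
move=> l2; rewrite /critical_ratio_spec /=.
pose p : {poly R} := 'X^l - \sum_(i < l) 'X^i.
have pE x : p.[x] = x ^+ l - \sum_(i < l) x ^+ i.
  rewrite /p hornerD hornerN hornerXn horner_sum; congr (_ - _).
  by apply: eq_bigr => i _; rewrite hornerXn.
have p1 : p.[1] < 0.
  rewrite pE expr1n; under eq_bigr do rewrite expr1n.
  by rewrite sumr_const card_ord subr_lt0 ltr1n.
have p2 : p.[2] = 1.
  rewrite pE; have := subrX1 (2 : R) l.
  rewrite (_ : 2 - 1 = 1 :> R) ?mul1r; last by rewrite -[2]/(1 + 1) addrK.
  by move=> <-; rewrite opprB addrCA subrr addr0.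
have [||x /andP[x1 x2] /rootP px] := @poly_ivt R p 1 2.
- by rewrite ler1n.
- by rewrite p2 ler01 (ltW p1).
exists x; split; last by move: px; rewrite pE => /subr0_eq.
rewrite lt_neqAle x1 andbT; apply/eqP => x1E.
by move: p1; rewrite x1E px ltxx.
Qed.

Lemma critical_ratio_unique (l : nat) (x y : R) : (2 <= l)%N ->
  critical_ratio_spec l.+1 x -> critical_ratio_spec l.+1 y -> x = y.
Proof.
move=> l2; wlog xy : x y / x < y.
  move=> H hx hy; case: (ltgtP x y) => // xy; first exact: H.
  by apply/esym/H.
rewrite /critical_ratio_spec /= => -[x1 ex] [y1 ey].
have x0 : 0 < x by apply: lt_trans x1.
have y0 : 0 < y by apply: lt_trans y1.
have : x ^+ l * (\sum_(i < l) y ^+ i) < y ^+ l * (\sum_(i < l) x ^+ i).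
  rewrite !mulr_sumr; apply: ltr_sum => [|i _].
    by apply/hasP; exists (Ordinal (ltnW l2)); rewrite ?mem_index_enum.
  have il : (i < l)%N by [].
  move: (nat_of_ord i) il => {}i il; rewrite -(subnK (ltnW il)) !exprD.
  rewrite -!mulrA [y ^+ i * x ^+ i]mulrC.
  rewrite ltr_pM2r ?mulr_gt0 ?exprn_gt0//.
  by rewrite ltrXn2r ?(ltW x0)// -lt0n subn_gt0 il.
by rewrite -ey -ex mulrC ltxx.
Qed.

Lemma critical_ratioP (l : nat) : (2 <= l)%N ->
  critical_ratio_spec l.+1 (critical_ratio l.+1).
Proof. by move=> /critical_ratio_exists[x xP]; exact: (xgetI 0 xP). Qed.

End CriticalRatio.

(* Sequences indexed by k >= 1 in the usual notation are indexed from 0. *)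
Definition lacunary (R : realType) (lam : R) (N : nat -> nat) : Prop :=
  (forall k, (0 < N k)%N) /\
  (forall k, lam < (N k.+1)%:R / (N k)%:R).

Definition sums_of (N : nat -> nat) (s : nat) : set nat :=
  [set m | exists k : 'I_s -> nat,
    (forall i j : 'I_s, (i < j)%N -> (k j < k i)%N) /\
    m = (\sum_(i < s) N (k i))%N].

Definition sums_upto (N : nat -> nat) (l : nat) : set nat :=
  \bigcup_(s in [set s | (1 <= s <= l)%N]) sums_of N s.

(* The rows n = 1, 2, ... are indexed from 0. *)
Definition summation_matrix (R : realType) (t : nat -> int -> R[i]) : Prop :=
  [/\ forall n, finite_set [set m | t n m != 0],
      exists M : R, forall n m, `|t n m| <= M%:C &
      forall m : int, 0 < m -> t n m @[n --> \oo] --> (1 : R[i])].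

Definition expi (R : realType) (y : R) : R[i] := cos y +i* sin y.

(* [\sum_(m \in A) f m] is the sum over the finite set of m in A with
   f m != 0; it is 0 by convention if that set is infinite, which condition 1
   on a summation matrix excludes. *)
Definition matrix_sum (R : realType) (t : nat -> int -> R[i]) (A : set nat)
    (c : nat -> R[i]) (n : nat) (x : R) : R[i] :=
  \sum_(m \in A) t n m%:Z * c m * expi (2 * pi * m%:R * x).

(* Lebesgue (not only Borel) measurability: [completed_lebesgue_measure] lives
   on the Caratheodory sigma-algebra of the Lebesgue outer measure. *)
Definition Lebesgue_measurable (R : realType) (E : set R) : Prop :=
  (wlength (@idfun R))^*%mu.-cara.-measurable E.

(* Main.v *)
(* An integer has a bounded number of representations as a sum of at most 2l terms
   of a lacunary sequence, so it is a sum of two elements of [sums_upto N l] in at most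
   r = r(l, lam) ways.  Hence a trigonometric polynomial S with frequencies in
   [sums_upto N l] satisfies ||S||_4^4 <= r ||S||_2^4: apply Parseval to S^2, then
   Cauchy-Schwarz to its coefficients.  So on a set of measure close to 1, depending
   only on r, S cannot be uniformly small unless ||S||_2 is small.  The matrix sums S_n
   are uniformly small for large n on a subset of [0, 1] of measure still greater than
   alpha = 1 - 1/(4r), so ||S_n||_2 -> 0; as t_{n,m} -> 1, every c_m is 0. *)
Require Import Defs.
From mathcomp Require Import all_boot all_order all_algebra.
From mathcomp Require Import all_classical all_reals all_analysis.
From mathcomp Require Import complex measurable_realfun.
From mathcomp Require Import zify ring lra.

Set Implicit Arguments.
Unset Strict Implicit.
Unset Printing Implicit Defensive.

Import Order.TTheory GRing.Theory Num.Theory numFieldNormedType.Exports.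
Local Open Scope classical_set_scope.
Local Open Scope ring_scope.
Local Open Scope complex_scope.

(** * Bounded multiplicity of sums of lacunary terms *)

Lemma lacunary_ratio (R : realType) (lam : R) (N : nat -> nat) (k j : nat) :
  0 <= lam -> lacunary lam N -> lam ^+ j * (N k)%:R <= (N (k + j)%N)%:R.
Proof.
move=> lam0 [N0 Nlac]; elim: j => [|j IHj]; first by rewrite expr0 mul1r addn0.
rewrite exprS -mulrA addnS; apply: le_trans (_ : lam * (N (k + j)%N)%:R <= _).
  exact: ler_wpM2l.
by rewrite -ler_pdivlMr ?ltr0n ?N0// ltW.
Qed.

(** Lists with free order and repetitions, because concatenating the representations of two summands
    can repeat an index. *)
Definition subsum (N : nat -> nat) (u : seq nat) : nat := (\sum_(k <- u) N k)%N.

Lemma perm_subsum (N : nat -> nat) (u v : seq nat) :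
  perm_eq u v -> subsum N u = subsum N v.
Proof. by move=> uv; rewrite /subsum (perm_big _ uv). Qed.

Lemma subsum_le (N : nat -> nat) (u : seq nat) (k : nat) :
  {in u, forall j, N j <= N k}%N -> (subsum N u <= size u * N k)%N.
Proof.
move=> uk; rewrite /subsum big_seq -sum1_size big_distrl /= [leqRHS]big_seq.
by apply: leq_sum => j ju; rewrite mul1n uk.
Qed.

Lemma argmax_seq (N : nat -> nat) (x : nat) (w : seq nat) :
  exists2 k, k \in x :: w & {in x :: w, forall j, N j <= N k}%N.
Proof.
elim: w x => [|y w IHw] x.
  by exists x; rewrite ?inE// => j; rewrite inE => /eqP ->.
have [k kw kmax] := IHw y; have [xk|kx] := leqP (N x) (N k).
  exists k; first by rewrite inE kw orbT.
  by move=> j; rewrite inE => /orP[/eqP ->//|/kmax].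
exists x; first by rewrite inE eqxx.
move=> j; rewrite inE => /orP[/eqP ->//|/kmax jk].
exact: leq_trans jk (ltnW kx).
Qed.

(* The largest term [N k] of a representation of [M] by [s] terms satisfies
   [M / s <= N k <= M], which leaves at most [K] choices for [k]. *)
Lemma subsums_bounded (R : realType) (lam : R) (s K : nat) :
  1 < lam -> s%:R < lam ^+ K -> forall (N : nat -> nat), lacunary lam N ->
  forall (q : nat), (q <= s)%N -> forall M : nat,
  exists L : seq nat, (size L <= (2 * K) ^ q)%N /\
    forall u v : seq nat, (size u + size v = q)%N ->
      (subsum N u + subsum N v = M)%N -> subsum N u \in L.
Proof.
move=> lam1 sK N Nlac; have lam0 : 0 <= lam by apply: ltW; apply: lt_trans lam1.
have [N0 _] := Nlac; elim=> [|q IHq] qs M.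
  exists [:: 0%N]; split=> // u v /eqP; rewrite addn_eq0 => /andP[/nilP -> _] _.
  by rewrite /subsum big_nil inE.
(* [P k] is what the largest of [q.+1] terms with sum [M] must satisfy; if no [k] does, there is
   nothing to represent and the empty list serves. *)
pose P k := (M <= q.+1 * N k)%N.
have [[k0 Pk0]|nP] := pselect (exists k, P k); last first.
  exists [::]; split=> // u v uvq uvM; exfalso; apply: nP.
  have : size (u ++ v) = q.+1 by rewrite size_cat.
  case uvE : (u ++ v) => [//|x w] wq.
  have [k _ kmax] := argmax_seq N x w; exists k; rewrite /P -wq -uvM.
  by rewrite /subsum -big_cat uvE /= subsum_le.
have exP : exists k, P k by exists k0.
have [k1 Pk1 k1min] := ex_minnP exP.
have /choice[L LP] := IHq (ltnW qs).
(* The largest term [N k] is removed from the pair, with [k] among the [K] indices from [k1] on.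
   Taken from [v], it leaves the sum of [u] unchanged; taken from [u], it shifts that sum by [N k].
   The two cases and the [K] indices give the factor [2 * K]. *)
exists (flatten [seq L (M - N k)%N ++ map (addn (N k)) (L (M - N k)%N)
  | k <- iota k1 K]); split.
  rewrite size_flatten /shape -map_comp sumnE big_map.
  apply: leq_trans (_ : (\sum_(k <- iota k1 K) 2 * (2 * K) ^ q <= _)%N).
    apply: leq_sum => k _ /=; rewrite size_cat size_map addnn -mul2n.
    by rewrite leq_mul2l /=; have [] := LP (M - N k)%N.
  rewrite big_const_seq count_predT size_iota iter_addn_0 expnS; nia.
move=> u v uvq uvM.
have wq : size (u ++ v) = q.+1 by rewrite size_cat.
have wM : subsum N (u ++ v) = M by rewrite /subsum big_cat.
have [k kuv kmax] : exists2 k, k \in u ++ v & {in u ++ v, forall j, N j <= N k}%N.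
  by case uvE : (u ++ v) wq => [//|x w] _; exact: argmax_seq.
have Pk : P k by rewrite /P -wM -wq subsum_le.
have kM : (N k <= M)%N.
  by rewrite -wM /subsum (perm_big _ (perm_to_rem kuv)) big_cons leq_addr.
(* Otherwise [lam ^+ K * N k1 <= N k <= M <= q.+1 * N k1 <= s * N k1], against the choice of [K]. *)
have kK : (k < k1 + K)%N.
  rewrite ltnNge; apply/negP => Kk.
  have := lacunary_ratio k1 (k - k1) lam0 Nlac.
  have k1k := k1min _ Pk; rewrite subnKC// => h.
  have : lam ^+ K * (N k1)%:R <= s%:R * (N k1)%:R :> R.
    apply: le_trans (_ : (N k)%:R <= _).
      apply: le_trans h; rewrite ler_wpM2r// ler_eXn2l//.
      by rewrite leq_subRL // addnC addnC.
    rewrite -natrM ler_nat (leq_trans kM)// (leq_trans Pk1)//.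
    by rewrite leq_mul2r qs orbT.
  by rewrite ler_pM2r ?ltr0n// leNgt sK.
apply/flattenP.
exists (L (M - N k)%N ++ map (addn (N k)) (L (M - N k)%N)).
  by apply/mapP; exists k => //; rewrite mem_iota k1min.
have [_ Lk] := LP (M - N k)%N.
move: kuv; rewrite mem_cat => /orP[ku|kv].
- have pu := perm_to_rem ku; have su := perm_size pu.
  have uE := perm_subsum N pu.
  rewrite mem_cat; apply/orP; right; apply/mapP; exists (subsum N (rem k u)).
    apply: (Lk _ v); first by move: su uvq => /=; lia.
    by move: uvM; rewrite uE /subsum big_cons; lia.
  by rewrite uE /subsum big_cons.
- have pv := perm_to_rem kv; have sv := perm_size pv.
  have vE := perm_subsum N pv.
  rewrite mem_cat; apply/orP; left; apply: (Lk _ (rem k v)).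
    by move: sv uvq => /=; lia.
  by move: uvM; rewrite vE /subsum big_cons; lia.
Qed.

Lemma sums_uptoP (N : nat -> nat) (l m : nat) : sums_upto N l m ->
  exists2 u, (size u <= l)%N & subsum N u = m.
Proof.
move=> [s /= /andP[_ sl] [k [_ ->]]]; exists [seq k i | i <- index_enum 'I_s].
  by rewrite size_map -[index_enum _]enumT size_enum_ord.
by rewrite /subsum big_map.
Qed.

(** Each [i] counted is the sum of the first list in a pair of lists with total sum [M] and at most
    [l + l] terms, so [subsums_bounded] applies with [s = l + l]. The bound is built from [K] and
    [l] before [N] is introduced. *)
Lemma sums_upto_pairs_bounded (R : realType) (lam : R) (l : nat) : 1 < lam ->
  exists r : nat, (0 < r)%N /\ forall N : nat -> nat, lacunary lam N ->
  forall M : nat,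
  (\sum_(i < M.+1 | `[< sums_upto N l i /\ sums_upto N l (M - i)%N >]) 1 <= r)%N.
Proof.
move=> lam1.
have [K sK] : exists K, (l + l)%:R < lam ^+ K.
  have h : 0 < lam - 1 by rewrite subr_gt0.
  (* Bernoulli's inequality, from which a suitable [K] is read off. *)
  have bern n : 1 + n%:R * (lam - 1) <= lam ^+ n.
    elim: n => [|n IHn]; first by rewrite mul0r addr0 expr0.
    rewrite exprS; apply: le_trans (_ : lam * (1 + n%:R * (lam - 1)) <= _).
      have := mulr_ge0 (ler0n R n) (sqr_ge0 (lam - 1)); rewrite -natr1; nra.
    by rewrite ler_wpM2l// ltW// (lt_trans _ lam1).
  exists (Num.bound ((l + l)%:R / (lam - 1))).
  apply: lt_le_trans (bern _).
  have := archi_boundP (divr_ge0 (ler0n R (l + l)) (ltW h)).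
  by rewrite ltr_pdivrMr// => /lt_trans; apply; rewrite ltrDr ltr01.
pose r0 := (\sum_(a < l.+1) \sum_(b < l.+1) (2 * K) ^ (a + b))%N.
exists r0.+1; split=> // N Nlac M; apply: leqW.
have rep q : (q <= l + l)%N -> exists L : seq nat, (size L <= (2 * K) ^ q)%N /\
    forall u v : seq nat, (size u + size v = q)%N ->
      (subsum N u + subsum N v = M)%N -> subsum N u \in L.
  by move=> ql; exact: (subsums_bounded lam1 sK).
(* [choice] requires a list for every [q], so the restriction [q <= l + l] moves under the
   existential and larger [q] receive the empty list. *)
have /choice[L LP] q : exists L : seq nat, (q <= l + l)%N ->
    (size L <= (2 * K) ^ q)%N /\ forall u v : seq nat, (size u + size v = q)%N ->
      (subsum N u + subsum N v = M)%N -> subsum N u \in L.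
  have [/rep[L LP]|_] := leqP q (l + l); [by exists L|by exists [::]].
pose LL := flatten [seq L (val a + val b)%N | a <- enum 'I_l.+1, b <- enum 'I_l.+1].
have sLL : (size LL <= r0)%N.
  rewrite size_flatten /shape sumnE big_map big_allpairs_dep /= /r0.
  rewrite big_enum; apply: leq_sum => a _; rewrite big_enum.
  apply: leq_sum => b _; have [|//] := LP (a + b)%N.
  by rewrite leq_add// -ltnS.
apply: leq_trans sLL.
rewrite -(big_mkord (fun i => `[< sums_upto N l i /\ sums_upto N l (M - i)%N >])
  (fun=> 1%N)).
rewrite sum1_count -size_filter uniq_leq_size ?filter_uniq ?iota_uniq//.
move=> i; rewrite mem_filter mem_index_iota ltnS.
move=> /andP[/asboolP[/sums_uptoP[u ul uE] /sums_uptoP[v vl vE]] /andP[_ iM]].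
have uvl : (size u + size v <= l + l)%N by exact: leq_add.
have [_ /(_ u v erefl)] := LP _ uvl.
rewrite uE vE subnKC// => /(_ erefl) iL.
apply/flattenP; exists (L (size u + size v)%N) => //.
apply/allpairsP; exists (Ordinal (ul : (size u < l.+1)%N),
  Ordinal (vl : (size v < l.+1)%N)).
by rewrite !mem_enum.
Qed.

(** * Squared moduli and the coefficients of the square of a polynomial *)

(** The squared modulus with values in [R], whereas the norm of [R[i]] takes values in [R[i]]; means
    and integrals below are real. *)
Definition sqnormc (R : realType) (z : R[i]) : R :=
  complex.Re z ^+ 2 + complex.Im z ^+ 2.

Lemma sqnormc_ge0 (R : realType) (z : R[i]) : 0 <= sqnormc z.
Proof. by rewrite addr_ge0 ?sqr_ge0. Qed.

Lemma sqnormcM (R : realType) (z w : R[i]) :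
  sqnormc (z * w) = sqnormc z * sqnormc w.
Proof. by case: z w => [a b] [c d]; rewrite /sqnormc /=; ring. Qed.

Lemma sqnormc_sum (R : realType) (I : finType) (P : pred I) (w : I -> R[i]) :
  sqnormc (\sum_(i | P i) w i) =
  (\sum_(i | P i) complex.Re (w i)) ^+ 2 + (\sum_(i | P i) complex.Im (w i)) ^+ 2.
Proof.
rewrite /sqnormc; congr (_ ^+ 2 + _ ^+ 2).
  by apply: (big_morph (@complex.Re R)) => // -[a b] [c d].
by apply: (big_morph (@complex.Im R)) => // -[a b] [c d].
Qed.

(* Expanding [0 <= \sum (r x_i - S)^2], where [S] is the sum of the [x_i]. *)
Lemma sqr_sum_le (R : realType) (I : finType) (P : pred I) (x : I -> R) (r : nat) :
  (0 < r)%N -> (\sum_(i | P i) 1 <= r)%N ->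
  (\sum_(i | P i) x i) ^+ 2 <= r%:R * \sum_(i | P i) x i ^+ 2.
Proof.
move=> r0 cr; set S := \sum_(i | P i) x i; set Q := \sum_(i | P i) _.
have r0' : 0 < r%:R :> R by rewrite ltr0n.
have : 0 <= \sum_(i | P i) (r%:R * x i - S) ^+ 2.
  by apply: sumr_ge0 => i _; exact: sqr_ge0.
have -> : \sum_(i | P i) (r%:R * x i - S) ^+ 2 =
    r%:R ^+ 2 * Q - 2 * r%:R * S * S + (\sum_(i | P i) 1)%N%:R * S ^+ 2.
  have -> : 2 * r%:R * S * S = \sum_(i | P i) 2 * r%:R * S * x i.
    by rewrite -mulr_sumr.
  rewrite natr_sum mulr_suml /Q mulr_sumr -sumrB -big_split.
  by apply: eq_bigr => i _ /=; ring.
have : (\sum_(i | P i) 1)%N%:R * S ^+ 2 <= r%:R * S ^+ 2.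
  by rewrite ler_wpM2r ?sqr_ge0// ler_nat.
move=> h1 h2; rewrite -(ler_pM2l r0'); lra.
Qed.

Lemma sqnormc_sum_le (R : realType) (I : finType) (P : pred I) (w : I -> R[i])
    (r : nat) :
  (0 < r)%N -> (\sum_(i | P i) 1 <= r)%N ->
  sqnormc (\sum_(i | P i) w i) <= r%:R * \sum_(i | P i) sqnormc (w i).
Proof.
by move=> r0 cr; rewrite sqnormc_sum big_split mulrDr lerD// sqr_sum_le.
Qed.

(** A coefficient of [p * p] is a convolution with at most [r] nonzero terms, so Cauchy-Schwarz
    bounds its squared modulus by [r] times the convolution of the squared moduli. *)
Lemma sqnormc_coef_sqr_le (R : realType) (A : set nat) (r : nat) (p : {poly R[i]}) :
  (0 < r)%N ->
  (forall M, \sum_(i < M.+1 | `[< A i /\ A (M - i)%N >]) 1 <= r)%N ->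
  (forall i, p`_i != 0 -> A i) ->
  \sum_(M < size p + size p) sqnormc (p * p)`_M <=
  r%:R * (\sum_(i < size p) sqnormc p`_i) ^+ 2.
Proof.
move=> r0 Ar pA; pose q := \poly_(i < size p) sqnormc p`_i.
have qE i : q`_i = sqnormc p`_i.
  rewrite coef_poly; case: ltnP => // pi.
  by rewrite nth_default// /sqnormc /= expr0n addr0.
(* Evaluation at 1 is multiplicative, so the squared sum becomes the sum of the coefficients of
   [q * q], which is compared termwise with the left side. *)
have -> : \sum_(i < size p) sqnormc p`_i = q.[1].
  rewrite (@horner_coef_wide _ (size p)) ?size_poly//.
  by apply: eq_bigr => i _; rewrite qE expr1n mulr1.
rewrite expr2 -hornerM (@horner_coef_wide _ (size p + size p)); last first.
  rewrite (leq_trans (size_polyMleq _ _))// (leq_trans (leq_pred _))//.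
  by rewrite leq_add// size_poly.
rewrite mulr_sumr; apply: ler_sum => M _; rewrite expr1n mulr1 !coefM.
rewrite (bigID (fun i : 'I_M.+1 => `[< A i /\ A (M - i)%N >])) /=.
rewrite [X in _ + X]big1 ?addr0; last first.
  move=> i /asboolPn nA; apply/eqP; rewrite mulf_eq0 -[_ || _]negbK negb_or.
  by apply/negP => /andP[/pA Ai /pA AMi]; apply: nA.
apply: le_trans (sqnormc_sum_le _ r0 (Ar M)) _.
rewrite ler_wpM2l//.
rewrite [leLHS](eq_bigr (fun i : 'I_M.+1 => q`_i * q`_(M - i))); last first.
  by move=> i _; rewrite sqnormcM !qE.
rewrite [leRHS](bigID (fun i : 'I_M.+1 => `[< A i /\ A (M - i)%N >])) /= lerDl.
by apply: sumr_ge0 => i _; rewrite !qE mulr_ge0// sqnormc_ge0.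
Qed.

(** * Means over the unit interval *)

(* The mean of a continuous [f] over [0, 1] is [v]; stated through an antiderivative
   so that linearity needs no integrability side conditions. *)
Definition has_mean (R : realType) (f : R -> R) (v : R) : Prop :=
  continuous f /\
  exists2 G : R -> R, forall x : R, is_derive x (1 : R) G (f x) & G 1 - G 0 = v.

Lemma is_derive_mulr (R : realType) (a x : R) : is_derive x (1 : R) ( *%R a) a.
Proof.
have := is_deriveZ a (is_derive_id x (1 : R)).
by rewrite /GRing.scale /= mulr1.
Qed.

Lemma has_mean_cst (R : realType) (a : R) : has_mean (fun=> a) a.
Proof.
split; first by move=> x; exact: cvg_cst.
exists ( *%R a); last by rewrite mulr1 mulr0 subr0.
by move=> x; exact: is_derive_mulr.
Qed.

Lemma has_meanD (R : realType) (f g : R -> R) (u v : R) :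
  has_mean f u -> has_mean g v -> has_mean (fun x => f x + g x) (u + v).
Proof.
move=> [cf [F dF Fu]] [cg [G dG Gv]]; split.
  by move=> x; apply: continuousD; [exact: cf|exact: cg].
exists (F + G); last by rewrite -Fu -Gv !fctE; ring.
by move=> x; exact: is_deriveD.
Qed.

Lemma has_meanZ (R : realType) (f : R -> R) (a v : R) :
  has_mean f v -> has_mean (fun x => a * f x) (a * v).
Proof.
move=> [cf [F dF Fv]]; split.
  by move=> x; apply: continuousM; [exact: cvg_cst|exact: cf].
exists (a *: F); last by rewrite -Fv !fctE /GRing.scale /=; ring.
by move=> x; exact: is_deriveZ.
Qed.

Lemma has_mean_sum (R : realType) (I : Type) (s : seq I) (f : I -> R -> R)
    (v : I -> R) :
  (forall i, has_mean (f i) (v i)) ->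
  has_mean (fun x => \sum_(i <- s) f i x) (\sum_(i <- s) v i).
Proof.
move=> fv; elim: s => [|i s IHs].
  rewrite big_nil (_ : (fun x => _) = fun=> 0); first exact: has_mean_cst.
  by apply/funext => x; rewrite big_nil.
rewrite big_cons (_ : (fun x => _) = fun x => f i x + \sum_(i <- s) f i x).
  exact: has_meanD.
by apply/funext => x; rewrite big_cons.
Qed.

(** * Complex exponentials, orthogonality and Parseval's identity *)

Lemma expiD (R : realType) (x y : R) : expi (x + y) = expi x * expi y.
Proof. by rewrite /expi cosD sinD; apply/eqP; rewrite eq_complex /= eqxx addrC eqxx. Qed.

Lemma expiX (R : realType) (x : R) (n : nat) : expi x ^+ n = expi (n%:R * x).
Proof.
elim: n => [|n IHn]; first by rewrite expr0 mul0r /expi cos0 sin0.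
by rewrite exprS IHn -expiD -natr1 mulrDl mul1r addrC.
Qed.

Lemma expi_2pi_nat (R : realType) (n : nat) : expi (n%:R * (2 * pi)) = 1 :> R[i].
Proof.
by rewrite -expiX /expi mulr_natl cos2pi sin2pi expr1n.
Qed.

Lemma cos_sin_2pi_diff (R : realType) (m n : nat) :
  cos (2 * pi * (m%:R - n%:R)) = 1 :> R /\ sin (2 * pi * (m%:R - n%:R)) = 0 :> R.
Proof.
have := expi_2pi_nat R m; have := expi_2pi_nat R n.
rewrite mulrBr mulrC [_ * m%:R]mulrC cosB sinB => -[-> ->] [-> ->].
by split; ring.
Qed.

Lemma is_derive_continuous (R : realType) (f g : R -> R) :
  (forall x : R, is_derive x (1 : R) f (g x)) -> continuous f.
Proof.
by move=> fg x; apply/differentiable_continuous/derivable1_diffP; have [] := fg x.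
Qed.

Lemma is_derive_sin_mulr (R : realType) (k x : R) :
  is_derive x (1 : R) (sin \o *%R k) (cos (k * x) * k).
Proof. exact: is_derive1_comp (is_derive_sin (k * x)) (is_derive_mulr k x). Qed.

Lemma is_derive_cos_mulr (R : realType) (k x : R) :
  is_derive x (1 : R) (cos \o *%R k) (- sin (k * x) * k).
Proof. exact: is_derive1_comp (is_derive_cos (k * x)) (is_derive_mulr k x). Qed.

Lemma has_mean_cos (R : realType) (k : R) : k != 0 -> sin k = 0 ->
  has_mean (fun x => cos (k * x)) 0.
Proof.
move=> k0 sk; split; first exact: is_derive_continuous (is_derive_cos_mulr k).
exists (k^-1 *: (sin \o *%R k)).
  move=> x; apply: is_derive_eq (is_deriveZ k^-1 (is_derive_sin_mulr k x)) _.
  by rewrite /GRing.scale /= mulrCA mulVf ?mulr1.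
by rewrite !fctE /GRing.scale /= mulr1 mulr0 sk sin0 subrr.
Qed.

Lemma has_mean_sin (R : realType) (k : R) : k != 0 -> cos k = 1 ->
  has_mean (fun x => sin (k * x)) 0.
Proof.
move=> k0 ck; split; first exact: is_derive_continuous (is_derive_sin_mulr k).
exists ((- k^-1) *: (cos \o *%R k)).
  move=> x; apply: is_derive_eq (is_deriveZ (- k^-1) (is_derive_cos_mulr k x)) _.
  by rewrite /GRing.scale /= mulNr mulNr mulrN opprK mulrCA mulVf ?mulr1.
by rewrite !fctE /GRing.scale /= mulr1 mulr0 ck cos0 subrr.
Qed.

(** Orthogonality of the exponentials in real form: for [m != n] the frequency is a nonzero multiple
    of [2 * pi], and both antiderivatives take equal values at 0 and 1. *)
Lemma has_mean_trig (R : realType) (m n : nat) (a b : R) :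
  has_mean
    (fun x => a * cos (2 * pi * (m%:R - n%:R) * x) + b * sin (2 * pi * (m%:R - n%:R) * x))
    (if m == n then a else 0).
Proof.
have [<-|mn] := eqVneq m n.
  rewrite subrr mulr0 (_ : (fun x => _) = fun=> a); first exact: has_mean_cst.
  by apply/funext => x; rewrite mul0r cos0 sin0; ring.
set k := 2 * pi * _.
have k0 : k != 0.
  rewrite !mulf_neq0 ?pnatr_eq0 ?subr_eq0 ?eqr_nat//.
  by rewrite gt_eqF ?pi_gt0.
have [ck sk] := cos_sin_2pi_diff R m n.
rewrite (_ : 0 = a * 0 + b * 0); last by rewrite !mulr0 addr0.
apply: (@has_meanD _ (fun x => a * cos (k * x)) (fun x => b * sin (k * x))).
  exact/has_meanZ/has_mean_cos.
exact/has_meanZ/has_mean_sin.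
Qed.

(** The squared modulus expands into a double sum of which only the diagonal has nonzero mean. The
    free bound [n] allows summing the coefficients of [p * p] up to [size p + size p]. *)
Lemma parseval (R : realType) (p : {poly R[i]}) (n : nat) : (size p <= n)%N ->
  has_mean (fun x => sqnormc p.[expi (2 * pi * x)])
    (\sum_(i < n) sqnormc p`_i).
Proof.
move=> pn.
(* [u i j] and [- v i j] are the real and imaginary parts of the [i]-th coefficient times the
   conjugate of the [j]-th. *)
pose u (i j : nat) := complex.Re p`_i * complex.Re p`_j + complex.Im p`_i * complex.Im p`_j.
pose v (i j : nat) := complex.Re p`_i * complex.Im p`_j - complex.Im p`_i * complex.Re p`_j.
rewrite (_ : (fun x => _) = fun x => \sum_(i < n) \sum_(j < n)
  (u i j * cos (2 * pi * (i%:R - j%:R) * x) + v i j * sin (2 * pi * (i%:R - j%:R) * x))).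
  rewrite (_ : \sum_(i < n) _ = \sum_(i < n) \sum_(j < n)
    (if val i == val j then u i j else 0)).
    by apply: has_mean_sum => i; apply: has_mean_sum => j; exact: has_mean_trig.
  apply: eq_bigr => i _; rewrite (bigD1 i)//= eqxx big1 ?addr0; last first.
    by move=> j ji; rewrite val_eqE eq_sym (negbTE ji).
  by rewrite /sqnormc /u !expr2.
apply/funext => x; rewrite (horner_coef_wide _ pn) sqnormc_sum !expr2.
rewrite !big_distrlr -big_split; apply: eq_bigr => i _ /=.
rewrite -big_split; apply: eq_bigr => j _ /=; rewrite !expiX.
have -> : 2 * pi * (i%:R - j%:R) * x = i%:R * (2 * pi * x) - j%:R * (2 * pi * x).
  by ring.
rewrite cosB sinB /u /v /expi.
case: (p`_i) => a b; case: (p`_j) => c d /=; ring.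
Qed.

Lemma has_mean_integral (R : realType) (f : R -> R) (v : R) : has_mean f v ->
  (\int[lebesgue_measure]_(x in `[0%R, 1%R]) (f x)%:E = v%:E)%E.
Proof.
move=> [cf [G dG <-]]; have cG := is_derive_continuous dG.
rewrite (@continuous_FTC2 _ f G) ?ltr01//.
- by apply: continuous_subspaceT.
- split; first by move=> x _; have [] := dG x.
  + by apply: cvg_at_right_filter; exact: cG.
  + by apply: cvg_at_left_filter; exact: cG.
- by move=> x _; rewrite derive1E; have [_ ->] := dG x.
Qed.

Lemma has_mean_ge0 (R : realType) (f : R -> R) (v : R) :
  has_mean f v -> (forall x, 0 <= f x) -> 0 <= v.
Proof.
by move=> /has_mean_integral fv f0; rewrite -lee_fin -fv integral_ge0// => x _; rewrite lee_fin.
Qed.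

(** * From a large sublevel set to a bound on the mean *)

(* Integrate [y + b 1_F <= e + b + y^2 / (4 b)], with [b = r v], over [0, 1];
   off [F] this is AM-GM. *)
Lemma mean_le_of_large_sublevel (R : realType) (y : R -> R) (v w e : R) (r : nat)
    (F : set R) :
  has_mean y v -> has_mean (fun x => y x ^+ 2) w -> (forall x, 0 <= y x) ->
  (0 < r)%N -> w <= r%:R * v ^+ 2 -> 0 <= e ->
  measurable F -> F `<=` `[0, 1] -> (forall x, F x -> y x <= e) ->
  ((1 - (4 * r%:R)^-1)%:E < lebesgue_measure F)%E -> v <= 2 * e.
Proof.
move=> yv y2w y0 r0 wr e0 mF F01 ye muF.
have r0' : 0 < r%:R :> R by rewrite ltr0n.
(* The case [v = 0] is settled first, since [b = r v] occurs as a divisor below. *)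
have := has_mean_ge0 yv y0; rewrite le_eqVlt => /predU1P[<-|v0].
  by rewrite mulr_ge0.
pose b := r%:R * v; have b0 : 0 < b by rewrite mulr_gt0.
have hf : has_mean (fun x => (e + b) + (4 * b)^-1 * y x ^+ 2)
    ((e + b) + (4 * b)^-1 * w).
  apply: (@has_meanD _ (fun=> e + b)); first exact: has_mean_cst.
  exact: has_meanZ.
have mD : measurable (`[0%R, 1%R] : set R) by exact: measurable_itv.
have cmeas (f : R -> R) (u : R) : has_mean f u ->
    measurable_fun (`[0%R, 1%R] : set R) (EFin \o f).
  move=> [cf _]; apply/measurable_EFinP; apply: measurable_funTS.
  exact: continuous_measurable_fun.
have mI : measurable_fun (`[0%R, 1%R] : set R) (EFin \o (\1_F : R -> R)).
  by apply/measurable_EFinP; exact: measurable_indic.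
have mbI : measurable_fun (`[0%R, 1%R] : set R) (fun x : R => b%:E * (EFin \o (\1_F : R -> R)) x)%E.
  exact: measurable_funeM.
have : (\int[lebesgue_measure]_(x in `[0%R, 1%R]) ((y x)%:E + b%:E * (\1_F x)%:E)
    <= \int[lebesgue_measure]_(x in `[0%R, 1%R])
         ((e + b) + (4 * b)^-1 * y x ^+ 2)%:E)%E.
  apply: ge0_le_integral => //.
  - by move=> x _; rewrite -EFinM -EFinD lee_fin addr_ge0 ?mulr_ge0// ltW.
  - by apply: emeasurable_funD; [exact: cmeas yv|exact: mbI].
  - exact: cmeas hf.
  move=> x _; rewrite -EFinM -EFinD lee_fin indicE.
  have [xF|xF] := boolP (x \in F).
    rewrite mulr1 addrAC -lerBlDl.
    have yxe := ye x (set_mem xF).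
    have : 0 <= (4 * b)^-1 * y x ^+ 2 by rewrite mulr_ge0 ?sqr_ge0// invr_ge0 mulr_ge0// ltW.
    lra.
  rewrite mulr0 addr0 -(ler_pM2l (_ : 0 < 4 * b)) ?mulr_gt0//.
  rewrite mulrDr mulVKf ?gt_eqF ?mulr_gt0//.
  have := sqr_ge0 (y x - 2 * b); have := mulr_ge0 e0 (ltW b0); lra.
rewrite ge0_integralD//; last 3 first.
- by move=> x _; rewrite lee_fin.
- exact: cmeas yv.
- by move=> x _; rewrite -EFinM lee_fin mulr_ge0// ltW.
have -> : (\int[lebesgue_measure]_(x in `[0%R, 1%R]) (b%:E * (\1_F x)%:E) =
    b%:E * lebesgue_measure F)%E.
  have -> : lebesgue_measure F =
      (\int[lebesgue_measure]_(x in `[0%R, 1%R]) (\1_F x)%:E)%E.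
    by rewrite integral_indic// setIidl.
  by apply: ge0_integralZl_EFin; rewrite ?ltW// => x _; rewrite lee_fin.
rewrite (has_mean_integral yv) (has_mean_integral hf).
move=> h; have : (v%:E + b%:E * (1 - (4 * r%:R)^-1)%:E
    <= (e + b + (4 * b)^-1 * w)%:E)%E.
  by apply: le_trans h; rewrite leeD2l// lee_pmul2l ?lte_fin// ltW.
rewrite -EFinM -EFinD lee_fin.
(* The deficit [b / (4 r)] equals [v / 4] and [w / (4 b)] is at most [v / 4], which leaves
   [v <= e + v / 2]. This balance fixes the threshold [1 - 1 / (4 r)]. *)
have -> : b * (1 - (4 * r%:R)^-1) = b - v / 4.
  by rewrite /b; field; rewrite gt_eqF.
have : (4 * b)^-1 * w <= v / 4.
  rewrite mulrC ler_pdivrMr ?mulr_gt0//; apply: le_trans wr _.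
  by rewrite le_eqVlt /b; apply/orP; left; apply/eqP; field.
lra.
Qed.

(** As in Egorov's theorem: the points where the bound holds from rank [k] on form sets [F k] that
    increase with [k] and cover [E], so by continuity of the measure from below one of them has
    measure above [alpha]. *)
Lemma large_uniform_sublevel (R : realType) (alpha : \bar R) (E : set R)
    (y : nat -> R -> R) (e : R) :
  (forall n, continuous (y n)) -> E `<=` `[0, 1] ->
  (alpha < completed_lebesgue_measure E)%E ->
  (forall x, E x -> exists k, forall n, (k <= n)%N -> y n x <= e) ->
  exists k, exists F : set R, [/\ measurable F, F `<=` `[0, 1],
    (alpha < lebesgue_measure F)%E &
    forall n x, (k <= n)%N -> F x -> y n x <= e].
Proof.
move=> cy E01 aE Ey.
pose F k : set R := `[0, 1] `&` \bigcap_(n in [set n | (k <= n)%N]) (y n @^-1` `]-oo, e]).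
have mF k : measurable (F k).
  apply: measurableI; first exact: measurable_itv.
  apply: bigcap_measurable; first by exists k => /=.
  move=> n _; rewrite -[X in measurable X]setTI.
  apply: continuous_measurable_fun => //; exact: cy.
have F01 k : F k `<=` `[0, 1] by move=> x [].
have FE : E `<=` \bigcup_k F k.
  move=> x Ex; have [k kx] := Ey x Ex; exists k => //.
  by split; [exact: E01|move=> n /= /kx; rewrite in_itv].
have [k ak] : exists k, (alpha < lebesgue_measure (F k))%E.
  apply: contrapT => na; have : (lebesgue_measure (\bigcup_k F k) <= alpha)%E.
    have cvF : (lebesgue_measure \o F) k @[k --> \oo] -->
        lebesgue_measure (\bigcup_k F k).
      apply: nondecreasing_cvg_mu => //; first by apply: bigcup_measurable => k _; exact: mF.
      move=> m n mn; apply/subsetPset => x [x01 xF]; split=> // i /= ni.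
      by apply: xF => /=; exact: leq_trans ni.
    apply: (cvge_to_le cvF); apply: nearW => k /=.
    by rewrite leNgt; apply/negP => ak; apply: na; exists k.
  rewrite leNgt => /negP; apply; apply: lt_le_trans aE _.
  (* Both measures come from the same outer measure, whose monotonicity passes from [E] to the Borel
     union. *)
  exact: (le_outer_measure ((wlength (@idfun R))^*%mu)).
exists k, (F k); split=> // n x kn [_ xF].
by have := xF n kn; rewrite /= in_itv.
Qed.

(** * Matrix sums as polynomials, and the uniqueness theorem *)

Lemma normc_le_sqnormc (R : realType) (z : R[i]) (d : R) : 0 <= d ->
  `|z| <= d%:C -> sqnormc z <= d ^+ 2.
Proof.
move=> d0 zd; rewrite -lecR /sqnormc add_Re2_Im2 rmorphXn /=.
by rewrite lerXn2r// nnegrE ?normr_ge0// lecR.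
Qed.

(** The frequencies are natural numbers and a row has finite support, so the sum is a polynomial in
    [expi (2 * pi * x)], to which the coefficient estimates apply. *)
Lemma matrix_sum_horner (R : realType) (t : nat -> int -> R[i]) (A : set nat)
    (c : nat -> R[i]) (n : nat) : finite_set [set m | t n m != 0] ->
  exists p : {poly R[i]},
    (forall i, p`_i = if i \in A then t n i%:Z * c i else 0) /\
    forall x, matrix_sum t A c n x = p.[expi (2 * pi * x)].
Proof.
move=> /finite_seqP[s sE].
(* One more than the largest absolute value in the support of the row, hence a bound on the number
   of coefficients. *)
pose B := (\max_(m <- s) `|m|%N).+1.
have tB i : (B <= i)%N -> t n i%:Z = 0.
  move=> Bi; apply/eqP; apply: contraTT Bi => ti; rewrite -ltnNge.
  have /= is_ : [set` s] i%:Z by rewrite -sE.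
  by rewrite /B ltnS -[leqLHS]/`|i%:Z|%N leq_bigmax_seq.
pose a i := if i \in A then t n i%:Z * c i else 0.
exists (\poly_(i < B) a i); split=> [i|x].
  rewrite coef_poly; case: ltnP => // Bi.
  by rewrite /a tB// mul0r if_same.
rewrite horner_poly (fsbig_ord _ B (fun i => a i * expi (2 * pi * x) ^+ i)).
rewrite /matrix_sum [LHS]fsbig_mkcond [RHS]fsbig_mkcond.
apply: eq_fsbigr => i _; rewrite /patch /a expiX.
have -> : i%:R * (2 * pi * x) = 2 * pi * i%:R * x by ring.
case: ifPn => _; last by rewrite mul0r if_same.
case: ifPn => //; rewrite notin_setE /= => /negP; rewrite -leqNgt => /tB ->.
by rewrite !mul0r.
Qed.

Theorem theorem1p4 (R : realType) (l : nat) (lam : R) :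
  (2 <= l)%N -> critical_ratio R l.+1 < lam ->
  exists alpha : R, 0 < alpha < 1 /\
    forall (N : nat -> nat) (t : nat -> int -> R[i]) (c : nat -> R[i])
      (E : set R),
    lacunary lam N -> summation_matrix t ->
    Lebesgue_measurable E -> E `<=` `]0, 1[ ->
    (alpha%:E < completed_lebesgue_measure E)%E ->
    (forall x, E x ->
       matrix_sum t (sums_upto N l) c n x @[n --> \oo] --> (0 : R[i])) ->
    forall m, sums_upto N l m -> c m = 0.
Proof.
move=> l2 crlam; have [cr1 _] := critical_ratioP R l2.
have [r [r0 rP]] := sums_upto_pairs_bounded l (lt_trans cr1 crlam).
have r1 : 1 <= r%:R :> R by rewrite ler1n.
exists (1 - (4 * r%:R)^-1); split.
  rewrite ltrBlDr ltrDl invr_gt0 subr_gt0 invf_lt1; last lra.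
  by apply/andP; split; lra.
move=> N t c E Nlac [tfin _ tlim] _ E01 muE S0 m Am.
pose A := sums_upto N l; have {}rP := rP N Nlac.
have /choice[p pP] n := matrix_sum_horner A c (tfin n).
pose v n := \sum_(i < size (p n)) sqnormc (p n)`_i.
pose w n := \sum_(M < size (p n) + size (p n)) sqnormc (p n * p n)`_M.
pose y n x := sqnormc (p n).[expi (2 * pi * x)].
have yv n : has_mean (y n) (v n) by exact: parseval.
(* The 8 is 2 times 4: [v n <= 2 * d ^+ 2] for large [n], and [t n m] within 1/2 of 1 has squared
   modulus at least 1/4, which costs 4 in passing from the coefficient of [p n] to [c m]. *)
have small d : 0 < d -> sqnormc (c m) <= 8 * d ^+ 2.
  move=> d0; have dC : 0 < d%:C :> R[i] by rewrite ltcR.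
  have [k [F [mF F01 muF Fy]]] : exists k, exists F : set R,
      [/\ measurable F, F `<=` `[0, 1],
      ((1 - (4 * r%:R)^-1)%:E < lebesgue_measure F)%E &
      forall n x, (k <= n)%N -> F x -> y n x <= d ^+ 2].
    apply: (large_uniform_sublevel _ _ muE); first by move=> n; have [] := yv n.
      by apply: subset_trans E01 _; exact: subset_itv_oo_cc.
    move=> x Ex; have /cvgr0Pnorm_le /(_ _ dC) [k _ kP] := S0 x Ex.
    exists k => n kn; rewrite /y -(pP n).2.
    by apply: normc_le_sqnormc; [exact: ltW|exact: kP].
  have vd n : (k <= n)%N -> v n <= 2 * d ^+ 2.
    move=> kn; apply: (@mean_le_of_large_sublevel _ (y n) (v n) (w n) _ r F) => //.
    (* The fourth power of the modulus of [p n] is the squared modulus of [p n * p n], so its mean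
       comes from Parseval's identity for the square. *)
    - rewrite (_ : (fun x => _) = fun x => sqnormc (p n * p n).[expi (2 * pi * x)]).
        apply: parseval.
        by rewrite (leq_trans (size_polyMleq _ _))// leq_pred.
      by apply/funext => x; rewrite hornerM sqnormcM expr2.
    - by move=> x; exact: sqnormc_ge0.
    - apply: (@sqnormc_coef_sqr_le _ A) => // i; rewrite (pP n).1.
      by case: ifP => [/set_mem//|_]; rewrite eqxx.
    - exact: sqr_ge0.
    - by move=> x; exact: Fy.
  (* Condition 3 concerns positive indices only; [m] is a sum of at least one positive term. *)
  have m0 : 0 < (m%:Z : int).
    have [s /= /andP[s1 _] [u [_ ->]]] := Am.
    rewrite ltz_nat (bigD1 (Ordinal s1))//= ltn_addr//.
    by have [] := Nlac.
  have h2 : 0 < (2^-1)%:C :> R[i] by rewrite ltcR invr_gt0.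
  have /cvgrPdist_le /(_ _ h2) [k' _ k'P] := tlim _ m0.
  pose n := maxn k k'.
  have tn : sqnormc (1 - t n m%:Z) <= 2^-1 ^+ 2.
    by apply: normc_le_sqnormc; [rewrite invr_ge0|apply: k'P; exact: leq_maxr].
  have tge : 4^-1 <= sqnormc (t n m%:Z).
    move: tn; rewrite /sqnormc; case: (t n m%:Z) => a b /=; nra.
  have : sqnormc (p n)`_m <= v n.
    rewrite /v; have [mn|mn] := ltnP m (size (p n)).
      rewrite (bigD1 (Ordinal mn))//= lerDl.
      by apply: sumr_ge0 => i _; exact: sqnormc_ge0.
    rewrite nth_default// /sqnormc /= expr0n addr0.
    by apply: sumr_ge0 => i _; exact: sqnormc_ge0.
  rewrite (pP n).1 mem_set// sqnormcM => tcv.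
  have := vd n (leq_maxl _ _); have := sqnormc_ge0 (c m); nra.
have : sqnormc (c m) <= 0.
  apply/ler_addgt0Pr => e e0; rewrite add0r.
  have /small : 0 < Num.sqrt (e / 8) by rewrite sqrtr_gt0 divr_gt0.
  by rewrite sqr_sqrtr ?divr_ge0 ?(ltW e0)// mulrC divfK.
rewrite /sqnormc; case: (c m) => a b /= ab.
have /eqP : a ^+ 2 + b ^+ 2 = 0 by apply/le_anti; rewrite ab addr_ge0 ?sqr_ge0.
rewrite paddr_eq0 ?sqr_ge0// !sqrf_eq0 => /andP[/eqP -> /eqP ->].
by [].
Qed.
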